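(* The (partial) map $\psi:\omega(\mathbb{R}^n)\times\mathbb{R}^n\to\mathcal{A}(\mathbb{R}^n)$, $(f,x_0)\mapsto\overline{W^u_f(x_0)}$ (the closure of $W^u_f(x_0)$), is not computable, where $(f,x_0)\in\mathrm{dom}(\psi)$ if $x_0$ is a hyperbolic equilibrium point of $\dot{x}=f(x)$, and $W^u_f(x_0)$ is the global unstable manifold of $f$ at $x_0$.
   Context: $\omega(\mathbb{R}^n)$ is the set of real analytic functions $f:\mathbb{R}^n\to\mathbb{R}^n$; $\mathcal{A}(\mathbb{R}^n)$ is the set of all closed subsets of $\mathbb{R}^n$. A point $x_0$ is a hyperbolic equilibrium of $\dot{x}=f(x)$ if $f(x_0)=0$ and no eigenvalue of $Df(x_0)$ has zero real part. Global unstable manifold: $W^u_f(x_0)=\bigcup_{j=0}^\infty\phi_{j}(U)$, where $U$ is a local unstable manifold of $f$ at $x_0$ as given by the Stable Manifold Theorem and $\phi_t(A)=\{x(t): x \text{ is a solution of } \dot{x}=f(x) \text{ with } x(0)\in A\}$; equivalently, it is the set of all points whose solution is defined for all $t\le 0$ and converges to $x_0$ as $t\to-\infty$. Solutions are not required to exist for all times. Names: a $\rho$-name of a real $x$ is a sequence of rationals $r_k$ (coded by natural numbers) with $|r_k-x|\le 2^{-k}$ for all $k$; names of points of $\mathbb{R}^n$ are componentwise; a name of a sequence of points consists of names of all its terms. Write $B(a,r)=\{x\in\mathbb{R}^n:|x-a|<r\}$ and fix a computable sequence of rational balls $B(a_k,r_k)$ with $\bigcup_k B(a_k,r_k)=\mathbb{R}^n$.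 A $\rho$-name of a function $f$ (here $f\in\omega(\mathbb{R}^n)$, regarded as a $C^1$ function) is a sequence $\{P_l\}$ of polynomial maps $\mathbb{R}^n\to\mathbb{R}^n$ with rational coefficients with $d(f,P_l)\le 2^{-l}$ for all $l$, where $d(f,P)=\sum_{k=0}^\infty 2^{-k}\left(\frac{\|f-P\|_k}{1+\|f-P\|_k}+\frac{\|Df-DP\|_k}{1+\|Df-DP\|_k}\right)$ and $\|g\|_k=\max_{x\in\overline{B(a_k,r_k)}}|g(x)|$. A name of a pair is a pair of names. A name of a closed set $X$ consists of (i) a name of a sequence of points of $\mathbb{R}^n$ dense in $X$, together with (ii) a sequence of pairs $(c_k,s_k)\in\mathbb{Q}^n\times\mathbb{Q}$ with $\mathbb{R}^n\setminus X=\bigcup_k B(c_k,s_k)$; the topology on $\mathcal{A}(\mathbb{R}^n)$ induced by these names is the Wijsman topology. Computability: a (partial) map $g$ is computable if there is a Type-2 machine (a Turing machine with infinite input sequence and one-way infinite output) that on any name of any $x\in\mathrm{dom}(g)$ outputs a name of $g(x)$. *)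

(* Defs.v *)
From HB Require Import structures.
From mathcomp Require Import all_boot all_order all_algebra.
From mathcomp Require Import all_classical all_reals all_analysis.
From mathcomp Require Import complex.

Set Implicit Arguments.
Unset Strict Implicit.
Unset Printing Implicit Defensive.

Import Order.TTheory GRing.Theory Num.Theory.
Import numFieldNormedType.Exports.

Local Open Scope classical_set_scope.
Local Open Scope ring_scope.

(* Type-2 Turing machines: a one-way read-only input tape and a one-way
   write-only output tape over {0,1}, and one two-way infinite work tape over
   an arbitrary finite alphabet. *)

Inductive direction := MoveLeft | Stay | MoveRight.

Record type2_machine := Type2Machine {
  tm_state : finType;
  tm_symbol : finType;
  tm_blank : tm_symbol;
  tm_start : tm_state;
  (* (state, input bit, work symbol) |-> (new state, symbol written on the
     work tape, move of the work head, whether the input head advances, bit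
     appended to the output if any) *)
  tm_step : tm_state -> bool -> tm_symbol ->
    tm_state * tm_symbol * direction * bool * option bool }.

Record tm_config (M : type2_machine) := TMConfig {
  cf_state : tm_state M;
  cf_input : nat;
  cf_head : int;
  cf_work : int -> tm_symbol M;
  cf_output : seq bool }.

Definition shift_head (d : direction) (h : int) : int :=
  match d with MoveLeft => h - 1 | Stay => h | MoveRight => h + 1 end.

Definition tm_init (M : type2_machine) : tm_config M :=
  TMConfig (tm_start M) 0%N 0 (fun=> tm_blank M) [::].

Definition tm_next (M : type2_machine) (input : nat -> bool)
    (c : tm_config M) : tm_config M :=
  let: (s, w, d, adv, out) :=
    tm_step (cf_state c) (input (cf_input c)) (cf_work c (cf_head c)) in
  TMConfig s (cf_input c + adv)%N (shift_head d (cf_head c))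
    (fun h => if h == cf_head c then w else cf_work c h)
    (if out is Some b then rcons (cf_output c) b else cf_output c).

Definition tm_run (M : type2_machine) (input : nat -> bool) (t : nat) :
  tm_config M := iter t (tm_next input) (tm_init M).

(* The sequence p is written on a tape as 1^(p 0) 0 1^(p 1) 0 1^(p 2) 0 ...;
   its k-th zero is at position p 0 + ... + p k + k. *)
Definition tape_of (p : nat -> nat) (j : nat) : bool :=
  ~~ [exists k : 'I_j.+1, j == (\sum_(i < k.+1) p i + k)%N].

(* On input p, the machine writes the whole infinite sequence q. *)
Definition computes (M : type2_machine) (p q : nat -> nat) : Prop :=
  forall m : nat, exists t : nat,
    take m (cf_output (tm_run M (tape_of p) t)) = mkseq (tape_of q) m.

Definition computable_sequence (q : nat -> nat) : Prop :=
  exists M : type2_machine, computes M (fun=> 0%N) q.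

Definition type2_computable (X Y : Type) (nameX : (nat -> nat) -> X -> Prop)
    (nameY : (nat -> nat) -> Y -> Prop) (dom : set X) (g : X -> Y) : Prop :=
  exists M : type2_machine, forall (x : X) (p : nat -> nat),
    dom x -> nameX p x -> exists2 q, computes M p q & nameY q (g x).

(* Finite rational objects are coded by natural numbers with [pickle]; pairs of
   names are interleaved. *)

Definition fst_name (p : nat -> nat) : nat -> nat := fun k => p k.*2.
Definition snd_name (p : nat -> nat) : nat -> nat := fun k => p k.*2.+1.

Definition pair_name (X Y : Type) (nameX : (nat -> nat) -> X -> Prop)
    (nameY : (nat -> nat) -> Y -> Prop) (p : nat -> nat) (z : X * Y) : Prop :=
  nameX (fst_name p) z.1 /\ nameY (snd_name p) z.2.

Definition seq_name (X : Type) (nameX : (nat -> nat) -> X -> Prop)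
    (p : nat -> nat) (x : nat -> X) : Prop :=
  forall m, nameX (fun k => p (pickle (m, k))) (x m).

(* The Euclidean norm; the library norm `|_| on matrices is the max norm. *)
Definition enorm (R : realType) (m n : nat) (A : 'M[R]_(m, n)) : R :=
  Num.sqrt (\sum_i \sum_j A i j ^+ 2).

Definition eball (R : realType) (n : nat) (a : 'rV[R]_n) (r : R) :
  set 'rV[R]_n := [set x | enorm (x - a) < r].

Definition rat_vec (R : realType) (n : nat) (a : 'rV[rat]_n) : 'rV[R]_n :=
  map_mx ratr a.

Definition rat_ball (R : realType) (n : nat) (c : 'rV[rat]_n) (s : rat) :
  set 'rV[R]_n := eball (rat_vec R c) (ratr s).
Arguments rat_ball R {n} c s.

Definition point_name (R : realType) (n : nat) (p : nat -> nat)
    (x : 'rV[R]_n) : Prop :=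
  exists r : nat -> 'rV[rat]_n, forall k,
    p k = pickle (r k) /\
    forall i, `|ratr (r k ord0 i) - x ord0 i| <= 2 ^- k.

Definition closed_set_name (R : realType) (n : nat) (p : nat -> nat)
    (X : set 'rV[R]_n) : Prop :=
  (exists x : nat -> 'rV[R]_n,
    [/\ seq_name (@point_name R n) (fst_name p) x,
        forall k, X (x k) &
        X `<=` closure (range x)]) /\
  (exists (c : nat -> 'rV[rat]_n) (s : nat -> rat),
    (forall k, snd_name p k = pickle (c k, s k)) /\
    ~` X = \bigcup_k rat_ball R (c k) (s k)).

(* A polynomial map with rational coefficients: for each component, a finite
   list of terms (coefficient, exponents). *)
Definition rat_polymap (n : nat) := n.-tuple (seq (rat * n.-tuple nat)).

Definition polymap_eval (R : realType) (n : nat) (P : rat_polymap n)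
    (x : 'rV[R]_n) : 'rV[R]_n :=
  \row_i \sum_(c <- tnth P i)
    ratr c.1 * \prod_(j < n) x ord0 j ^+ tnth c.2 j.

Definition sup_norm_on (R : realType) (T : Type) (m n : nat) (K : set T)
    (g : T -> 'M[R]_(m, n)) : R := sup [set enorm (g x) | x in K].

Section C1Names.
Variables (R : realType) (n : nat).
Variables (a : nat -> 'rV[rat]_n) (r : nat -> rat).

Definition computable_ball_cover : Prop :=
  [/\ forall k, 0 < r k,
      computable_sequence (fun k => pickle (a k, r k)) &
      \bigcup_k rat_ball R (a k) (r k) = setT].

Definition C1_dist (f g : 'rV[R]_n -> 'rV[R]_n) : R :=
  let K k := closure (rat_ball R (a k) (r k)) in
  let d0 k := sup_norm_on (K k) (fun x => f x - g x) in
  let d1 k := sup_norm_on (K k) (fun x => 'J f x - 'J g x) in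
  limn (series (fun k => 2 ^- k * (d0 k / (1 + d0 k) + d1 k / (1 + d1 k)))).

Definition function_name (p : nat -> nat) (f : 'rV[R]_n -> 'rV[R]_n) : Prop :=
  exists P : nat -> rat_polymap n, forall l,
    p l = pickle (P l) /\ C1_dist f (polymap_eval (P l)) <= 2 ^- l.

End C1Names.

(* Partial sum, over the multi-indices with all entries < N, of the power
   series with coefficients c at h. *)
Definition mpower_sum (R : realType) (n : nat) (c : ('I_n -> nat) -> R)
    (h : 'I_n -> R) (N : nat) : R :=
  \sum_(alpha : {ffun 'I_n -> 'I_N})
    c (fun i => nat_of_ord (alpha i)) * \prod_i h i ^+ alpha i.

(* Near every point, each component of f is the sum of an absolutely
   convergent power series. *)
Definition real_analytic (R : realType) (n : nat)
    (f : 'rV[R]_n -> 'rV[R]_n) : Prop :=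
  forall (x0 : 'rV[R]_n) (i : 'I_n),
  exists (c : ('I_n -> nat) -> R) (e : R), 0 < e /\
  forall x, eball x0 e x ->
    let h j := x ord0 j - x0 ord0 j in
    cvgn (mpower_sum (fun alpha => `|c alpha|) (fun j => `|h j|)) /\
    mpower_sum c h @ \oo --> f x ord0 i.

(* 'J f x acts on row vectors on the right: it is the transpose of the usual
   Df(x), and left eigenvectors are the usual eigenvectors of Df(x). *)
Definition complexified (R : realType) (m n : nat) (A : 'M[R]_(m, n)) :
  'M[R[i]]_(m, n) := map_mx (real_complex R) A.

Definition hyperbolic_equilibrium (R : realType) (n : nat)
    (f : 'rV[R]_n -> 'rV[R]_n) (x0 : 'rV[R]_n) : Prop :=
  f x0 = 0 /\
  forall z : R[i], eigenvalue (complexified ('J f x0)) z -> complex.Re z != 0.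

Definition unstable_gen_eigenvector (R : realType) (n : nat) (A : 'M[R]_n)
    (w : 'rV[R[i]]_n) : Prop :=
  exists (z : R[i]) (m : nat),
    0 < complex.Re z /\ iter m (mulmxr (complexified A - z%:M)) w = 0.

(* The unstable subspace of the linear system v' = v *m A: the real vectors
   in the span of the generalized eigenvectors of A for the eigenvalues with
   positive real part. *)
Definition unstable_subspace (R : realType) (n : nat) (A : 'M[R]_n) :
    set 'rV[R]_n :=
  [set v | exists2 s : seq 'rV[R[i]]_n,
     forall w, w \in s -> unstable_gen_eigenvector A w &
     complexified v = \sum_(w <- s) w].

Definition solution_on (R : realType) (n : nat) (f : 'rV[R]_n -> 'rV[R]_n)
    (I : set R) (x : R -> 'rV[R]_n) : Prop :=
  forall t : R, I t -> is_derive t 1 x (f (x t)).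

Definition flow (R : realType) (n : nat) (f : 'rV[R]_n -> 'rV[R]_n) (t : R)
    (A : set 'rV[R]_n) : set 'rV[R]_n :=
  [set y | exists (x : R -> 'rV[R]_n) (b c : R),
     [/\ b < 0 < c, b < t < c, solution_on f `]b, c[ x, A (x 0) & x t = y]].

(* g is a C^1 immersion of the open unit ball of R^k and a homeomorphism onto
   its image. *)
Definition C1_embedded_disc (R : realType) (n k : nat)
    (g : 'rV[R]_k -> 'rV[R]_n) : Prop :=
  [/\ forall y, eball 0 1 y -> differentiable g y,
      forall y, eball 0 1 y -> {for y, continuous (fun y => 'J g y)},
      forall y, eball 0 1 y -> row_free ('J g y) &
      exists2 h : 'rV[R]_n -> 'rV[R]_k,
        {within g @` eball 0 1, continuous h} &
        forall y, eball 0 1 y -> h (g y) = y].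

(* The conclusion of the Stable Manifold Theorem for the unstable manifold:
   U is a C^1 manifold (here, an embedded disc) through x0, tangent at x0 to
   the unstable subspace (hence of the same dimension), invariant under the
   backward flow, whose points converge to x0 as t --> -oo. *)
Definition local_unstable_manifold (R : realType) (n : nat)
    (f : 'rV[R]_n -> 'rV[R]_n) (x0 : 'rV[R]_n) (U : set 'rV[R]_n) : Prop :=
  [/\ exists (k : nat) (g : 'rV[R]_k -> 'rV[R]_n),
        [/\ C1_embedded_disc g, U = g @` eball 0 1, g 0 = x0 &
            forall v, (v <= 'J g 0)%MS <-> unstable_subspace ('J f x0) v],
      forall t : R, t <= 0 -> flow f t U `<=` U &
      forall p, U p -> exists (x : R -> 'rV[R]_n) (c : R),
        [/\ 0 < c, solution_on f `]-oo, c[ x, x 0 = p & x @ -oo --> x0]].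

(* The union over j of the phi_j(U) does not depend on the local unstable
   manifold U; the union is taken over all of them to avoid a choice. *)
Definition unstable_manifold (R : realType) (n : nat)
    (f : 'rV[R]_n -> 'rV[R]_n) (x0 : 'rV[R]_n) : set 'rV[R]_n :=
  \bigcup_(U in local_unstable_manifold f x0) \bigcup_(j : nat) flow f j%:R U.

Section Psi.
Variables (R : realType) (n : nat).

Definition psi_dom : set (('rV[R]_n -> 'rV[R]_n) * 'rV[R]_n) :=
  [set fx | real_analytic fx.1 /\ hyperbolic_equilibrium fx.1 fx.2].

Definition psi (fx : ('rV[R]_n -> 'rV[R]_n) * 'rV[R]_n) : set 'rV[R]_n :=
  closure (unstable_manifold fx.1 fx.2).

End Psi.

(* Main.v *)
(* The map psi is not even continuous. For e >= 0 let
     f_e(x) = ((1 - x_0)^2 + e x_0^2) x,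
   a radial polynomial field with Df_e(0) the identity, so that 0 is a source.
   For e = 0 the hyperplane x_0 = 1 consists of equilibria and the unstable
   manifold stays in x_0 < 1; for e > 0 every ray from the origin is a single
   trajectory and the unstable manifold is the whole space. On a name of
   (f_0, 0), a machine computing psi must at some point write a ball of the
   complement containing (2, 0, ..., 0); by then it has read only finitely many
   approximations, and these also begin a name of (f_e, 0) for small e > 0. *)

Require Import Defs.
From mathcomp Require Import all_boot all_order all_algebra.
From mathcomp Require Import all_classical all_reals all_analysis.
From mathcomp Require Import complex ring lra zify.

Set Implicit Arguments.
Unset Strict Implicit.
Unset Printing Implicit Defensive.

Import Order.TTheory GRing.Theory Num.Theory.
Import numFieldNormedType.Exports.

Local Open Scope classical_set_scope.
Local Open Scope ring_scope.

(** * Finite prefixes read and written by Type-2 machines *)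

Section Tapes.
Local Open Scope nat_scope.
Implicit Types p q : nat -> nat.

(* The position of the k-th zero of tape_of p. *)
Definition tape_zero p k : nat := \sum_(i < k.+1) p i + k.

Lemma tape_zeroS p k : tape_zero p k.+1 = tape_zero p k + (p k.+1).+1.
Proof. by rewrite /tape_zero big_ord_recr /=; lia. Qed.

Lemma tape_zero_lt p : {homo tape_zero p : k l / k < l}.
Proof.
apply: homo_ltn => [? ? ?|k]; first exact: ltn_trans.
by rewrite tape_zeroS; lia.
Qed.

Lemma tape_zero_le p : {mono tape_zero p : k l / k <= l}.
Proof. exact/leq_mono/tape_zero_lt. Qed.

Lemma tape_ofP p j :
  reflect (exists k, j = tape_zero p k) (~~ tape_of p j).
Proof.
rewrite negbK; apply: (iffP existsP) => [[k /eqP ->]|[k jk]]; first by exists k.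
have kj : k < j.+1 by rewrite jk /tape_zero; lia.
by exists (Ordinal kj); apply/eqP.
Qed.

Lemma tape_zero_agree p q t :
  (forall k, k <= t -> p k = q k) -> forall k, k <= t -> tape_zero p k = tape_zero q k.
Proof.
move=> pq k kt; congr (_ + _); apply: eq_bigr => i _; apply: pq.
exact: leq_trans (leq_ord i) kt.
Qed.

Lemma tape_of_agree p q t :
  (forall k, k <= t -> p k = q k) -> forall j, j <= t -> tape_of p j = tape_of q j.
Proof.
move=> pq j jt; apply: negb_inj; apply/idP/idP => /tape_ofP[k jk];
  apply/tape_ofP; exists k; rewrite jk; [|symmetry];
  apply: (tape_zero_agree pq); apply: leq_trans jt;
  by rewrite jk /tape_zero; lia.
Qed.

(** Strong induction on [i]: when the entries before [i] agree, the [i]-th zero of one tape is a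
    zero of the other, necessarily of index at least [i], which bounds one entry by the other.
    [next] is applied in both directions. *)
Lemma tape_of_inj_prefix p q m :
  (forall j, j <= tape_zero p m -> tape_of p j = tape_of q j) ->
  forall i, i <= m -> p i = q i.
Proof.
move=> pq i; elim/ltn_ind: i => i IH im.
have next (p1 q1 : nat -> nat) : (forall j, j < i -> p1 j = q1 j) ->
    (exists k, tape_zero p1 i = tape_zero q1 k) -> q1 i <= p1 i.
  move=> eqpq [k zk]; have ik : i <= k.
    case: i zk eqpq {IH im} => [//|i] zk eqpq.
    rewrite ltnNge -(tape_zero_le q1) -zk tape_zeroS.
    have -> := @tape_zero_agree p1 q1 i eqpq i (leqnn i).
    by rewrite -ltnNge addnS ltnS leq_addr.
  have E : \sum_(j < i) p1 j = \sum_(j < i) q1 j.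
    by apply: eq_bigr => j _; apply: eqpq.
  have := ik; rewrite -(tape_zero_le q1) -zk /tape_zero !big_ord_recr /= E.
  by rewrite leq_add2r leq_add2l.
have eqpq j : j < i -> p j = q j by move=> ji; apply: IH => //; lia.
have qp : q i <= p i.
  apply: next => //; apply/tape_ofP; rewrite -pq ?tape_zero_le //.
  by apply/tape_ofP; exists i.
apply/eqP; rewrite eqn_leq qp andbT; apply: next => [j ji|]; first by rewrite eqpq.
apply/tape_ofP; rewrite pq; first by apply/tape_ofP; exists i.
(* Agreement is known only up to [tape_zero p m]; the bound [q i <= p i] just obtained keeps the
   [i]-th zero of [q] in that range. *)
apply: (@leq_trans (tape_zero p i)); last by rewrite tape_zero_le.
have E : \sum_(j < i) p j = \sum_(j < i) q j by apply: eq_bigr => j _; apply: eqpq.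
by rewrite /tape_zero !big_ord_recr /= E leq_add2r leq_add2l.
Qed.

End Tapes.

Section Machines.
Variable M : type2_machine.

Lemma tm_runS input t : tm_run M input t.+1 = tm_next input (tm_run M input t).
Proof. by []. Qed.

Lemma tm_nextE input (c : tm_config M) :
  (cf_input (tm_next input c) <= (cf_input c).+1)%N /\
  exists s, cf_output (tm_next input c) = cf_output c ++ s.
Proof.
rewrite /tm_next; case: (tm_step _ _ _) => [[[[s w] d] adv] out] /=; split.
  by case: adv; rewrite ?addn0 ?addn1.
by case: out => [b|]; [exists [:: b]; rewrite cats1|exists [::]; rewrite cats0].
Qed.

Lemma cf_input_le input t : (cf_input (tm_run M input t) <= t)%N.
Proof.
elim: t => // t IH; rewrite tm_runS.
by apply: leq_trans (tm_nextE _ _).1 _.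
Qed.

Lemma cf_output_prefix input t u : (t <= u)%N ->
  exists s, cf_output (tm_run M input u) = cf_output (tm_run M input t) ++ s.
Proof.
move=> /subnK <-; elim: (u - t)%N => [|d [s IH]].
  by exists [::]; rewrite cats0.
rewrite addSn tm_runS; have [_ [s' ->]] := tm_nextE input (tm_run M input (d + t)).
by exists (s ++ s'); rewrite IH catA.
Qed.

(** The input head advances by at most one cell per step. *)
Lemma tm_run_agree (i1 i2 : nat -> bool) t :
  (forall j, (j <= t)%N -> i1 j = i2 j) -> tm_run M i1 t = tm_run M i2 t.
Proof.
elim: t => // t IH i12; rewrite !tm_runS -IH => [|j jt]; last exact/i12/leqW.
rewrite /tm_next i12 //; apply: leq_trans (cf_input_le _ _) _; exact: leqnSn.
Qed.

(** Continuity of computable maps. Take [t] to be a time by which the tape of [q] is written through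
    its [m]-th zero: only cells up to [t] have been read, and since each entry occupies at least one
    cell they are determined by the entries up to [t]. *)
Lemma computes_prefix p q : computes M p q -> forall m,
  exists t, forall p' q', computes M p' q' ->
    (forall k, (k <= t)%N -> p k = p' k) -> forall i, (i <= m)%N -> q i = q' i.
Proof.
move=> pq m; have [t qt] := pq (tape_zero q m).+1.
exists t => p' q' p'q' pp'; apply: tape_of_inj_prefix.
set l := (tape_zero q m).+1 in qt *.
have [u q'u] := p'q' l.
have sz (s : seq bool) f : take l s = mkseq f l -> (l <= size s)%N.
  move=> /(congr1 size); rewrite size_take size_mkseq.
  by case: ltnP => [/ltnW //|_ <-].
rewrite (tm_run_agree (tape_of_agree pp')) in qt.
suff Q : mkseq (tape_of q) l = mkseq (tape_of q') l.
  move=> j jm; have := congr1 (fun s => nth false s j) Q.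
  by rewrite !nth_mkseq.
(* Both words are outputs on the tape of [p'], with at least [l] bits each; the earlier one is a
   prefix of the later one. *)
rewrite -qt -q'u; have [tu|/ltnW ut] := leqP t u.
  have [s ->] := cf_output_prefix (tape_of p') tu.
  by rewrite takel_cat //; apply: sz qt.
have [s ->] := cf_output_prefix (tape_of p') ut.
by rewrite takel_cat //; apply: sz q'u.
Qed.

End Machines.

(** * Polynomial maps are analytic *)

Section PolynomialsAreAnalytic.
Variables (R : realType) (n : nat).
Implicit Types (s : seq (R * {ffun 'I_n -> nat})) (h : 'I_n -> R).

Definition monomial h (b : {ffun 'I_n -> nat}) : R := \prod_j h j ^+ b j.

Definition eval_terms s h : R := \sum_(t <- s) t.1 * monomial h t.2.

(** A list may repeat an exponent, so all terms carrying it are added up. *)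
Definition coef_of s (alpha : 'I_n -> nat) : R :=
  \sum_(t <- s | t.2 == finfun alpha) t.1.

(** The partial sums are constant once [N] exceeds every exponent. The coefficients are taken up to
    [=1] so that the series of absolute values is covered too. *)
Lemma cvg_mpower_sum s (c : ('I_n -> nat) -> R) h :
  c =1 coef_of s -> mpower_sum c h @ \oo --> eval_terms s h.
Proof.
move=> cE; apply: cvg_near_cst.
(* The sum of all exponents of all terms is a crude bound for each of them. *)
exists (\sum_(t <- s) \sum_j t.2 j).+1 => // N /= sN.
have tN t j : t \in s -> (t.2 j < N)%N.
  move=> ts; apply: leq_trans sN; rewrite ltnS (big_rem t) //= (bigD1 j) //=.
  by rewrite -addnA leq_addr.
rewrite /mpower_sum; transitivity (\sum_(alpha : {ffun 'I_n -> 'I_N})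
    \sum_(t <- s | t.2 == [ffun i => nat_of_ord (alpha i)]) t.1 * monomial h t.2).
  apply: eq_bigr => alpha _; rewrite cE mulr_suml; apply: eq_bigr => t /eqP ->.
  by congr (_ * _); apply: eq_bigr => i _; rewrite ffunE.
rewrite (exchange_big_dep xpredT) //= /eval_terms.
rewrite big_seq [RHS]big_seq; apply: eq_bigr => t ts.
rewrite (big_pred1 [ffun j => Ordinal (tN t j ts)]) // => alpha /=.
apply/eqP/eqP => [tE|->]; last by apply/ffunP => j; rewrite !ffunE.
by apply/ffunP => j; apply: val_inj; rewrite ffunE /= tE ffunE.
Qed.

(** The list [s'] has one term per distinct exponent, whence the [undup]: no two absolute values get
    added. *)
Lemma norm_coef_of s : exists s', (fun alpha => `|coef_of s alpha|) =1 coef_of s'.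
Proof.
exists [seq (`|coef_of s (fun i => fun_of_fin b i)|, b) | b <- undup (map snd s)] => alpha.
rewrite /coef_of big_map /=.
have [as_|asN] := boolP (finfun alpha \in undup (map snd s)); last first.
  rewrite !big1_seq ?normr0 // => -[] /=.
    by move=> b /andP[/eqP -> /(negP asN)].
  move=> c b /andP[/eqP /= -> cs]; move: asN.
  by rewrite mem_undup => /negP[]; apply/mapP; exists (c, finfun alpha).
rewrite -[RHS]big_filter (@eq_filter _ _ (pred1 (finfun alpha))) //.
rewrite filter_pred1_uniq ?undup_uniq // big_seq1.
by congr (`|_|); apply: eq_bigl => t; congr (_ == _); apply/ffunP => i; rewrite !ffunE.
Qed.

Definition poly_around (x0 : 'rV[R]_n) (F : 'rV[R]_n -> R) : Prop :=
  exists s, forall x, F x = eval_terms s (fun j => x ord0 j - x0 ord0 j).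

Section Closure.
Variable x0 : 'rV[R]_n.

Lemma poly_around_cst c : poly_around x0 (fun=> c).
Proof.
exists [:: (c, [ffun=> 0%N])] => x; rewrite /eval_terms big_seq1 /monomial.
by rewrite big1 ?mulr1 // => j _; rewrite ffunE.
Qed.

Lemma poly_aroundD F G : poly_around x0 F -> poly_around x0 G ->
  poly_around x0 (fun x => F x + G x).
Proof.
move=> [s Fs] [t Gt]; exists (s ++ t) => x.
by rewrite /eval_terms big_cat Fs Gt.
Qed.

Lemma poly_aroundM F G : poly_around x0 F -> poly_around x0 G ->
  poly_around x0 (fun x => F x * G x).
Proof.
move=> [s Fs] [t Gt].
exists [seq (u.1 * v.1, [ffun j => (u.2 j + v.2 j)%N]) |
  u : R * {ffun 'I_n -> nat} <- s, v : R * {ffun 'I_n -> nat} <- t] => x.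
rewrite /eval_terms big_allpairs_dep Fs Gt mulr_suml; apply: eq_bigr => u _ /=.
rewrite mulr_sumr; apply: eq_bigr => v _; rewrite mulrACA; congr (_ * _).
by rewrite /monomial -big_split; apply: eq_bigr => j _; rewrite ffunE exprD.
Qed.

Lemma poly_around_coord j : poly_around x0 (fun x => x ord0 j).
Proof.
have [s Hs] : poly_around x0 (fun x => x ord0 j - x0 ord0 j).
  exists [:: (1, [ffun k => (k == j : nat)])] => x.
  rewrite /eval_terms big_seq1 mul1r /monomial (bigD1 j) //= ffunE eqxx.
  by rewrite big1 ?mulr1 // => k /negbTE kj; rewrite ffunE kj.
have [t Ht] := poly_around_cst (x0 ord0 j).
have [u Hu] := poly_aroundD (ex_intro _ s Hs) (ex_intro _ t Ht).
by exists u => x; rewrite -Hu subrK.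
Qed.

Lemma poly_around_sum I (r : seq I) (F : I -> 'rV[R]_n -> R) :
  (forall i, poly_around x0 (F i)) -> poly_around x0 (fun x => \sum_(i <- r) F i x).
Proof.
move=> FP; elim: r => [|i r [s IH]].
  by have [s Hs] := poly_around_cst 0; exists s => x; rewrite big_nil -Hs.
have [u Hu] := poly_aroundD (FP i) (ex_intro _ s IH).
by exists u => x; rewrite big_cons -Hu.
Qed.

Lemma poly_around_prod I (r : seq I) (F : I -> 'rV[R]_n -> R) :
  (forall i, poly_around x0 (F i)) -> poly_around x0 (fun x => \prod_(i <- r) F i x).
Proof.
move=> FP; elim: r => [|i r [s IH]].
  by have [s Hs] := poly_around_cst 1; exists s => x; rewrite big_nil -Hs.
have [u Hu] := poly_aroundM (FP i) (ex_intro _ s IH).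
by exists u => x; rewrite big_cons -Hu.
Qed.

Lemma poly_aroundX F k : poly_around x0 F -> poly_around x0 (fun x => F x ^+ k).
Proof.
move=> FP; have [s Hs] := poly_around_prod (iota 0 k) (fun=> FP).
by exists s => x; rewrite -Hs big_const_seq count_predT size_iota -Monoid.iteropE.
Qed.

End Closure.

Lemma polymap_analytic (P : rat_polymap n) : real_analytic (@polymap_eval R n P).
Proof.
move=> x0 i; have [s Ps] : poly_around x0 (fun x => polymap_eval P x ord0 i).
  have [s Hs] : poly_around x0 (fun x => \sum_(c <- tnth P i)
      ratr c.1 * \prod_(j < n) x ord0 j ^+ tnth c.2 j).
    apply: poly_around_sum => c; apply: poly_aroundM; first exact: poly_around_cst.
    by apply: poly_around_prod => j; apply/poly_aroundX/poly_around_coord.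
  by exists s => x; rewrite mxE -Hs.
exists (coef_of s), 1; split => // x _ h; split.
  have [s' ss'] := norm_coef_of s.
  exact: (cvgP (eval_terms s' (fun j => `|h j|)) (cvg_mpower_sum ss')).

by rewrite Ps; apply: cvg_mpower_sum.
Qed.

End PolynomialsAreAnalytic.

(** * The C^1 distance *)

Section C1Distance.
Variable R : realType.

(** For [c > 0], if [A] is empty or unbounded above then so is its image, and both suprema take the
    default value 0. *)
Lemma sup_scale (c : R) (A : set R) : 0 <= c -> sup [set c * x | x in A] = c * sup A.
Proof.
rewrite le_eqVlt => /predU1P[<-|c0].
  rewrite mul0r; have [->|/set0P[a Aa]] := eqVneq A set0.
    by rewrite image_set0 sup0.
  rewrite (_ : [set _ | _ in _] = [set 0]) ?sup1 //.
  by apply/seteqP; split=> [_ [x _ <-]|_ ->] /=; [rewrite mul0r|exists a; rewrite ?mul0r].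
have [[[a Aa] [u Au]]|noA] := pselect (has_sup A); last first.
  rewrite (sup_out noA) mulr0 sup_out // => -[[_ [a Aa _]] [u Eu]]; apply: noA.
  split; first by exists a.
  exists (u / c) => x Ax; rewrite ler_pdivlMr // mulrC.
  by apply: Eu; exists x.
apply/eqP; rewrite eq_le; apply/andP; split.
  apply: ge_sup; first by exists (c * a), a.
  move=> _ [x Ax <-]; rewrite ler_pM2l //; apply: ub_le_sup => //; by exists u.
rewrite -ler_pdivlMl //; apply: ge_sup; first by exists a.
move=> x Ax; rewrite ler_pdivlMl //; apply: ub_le_sup; last by exists x.
by exists (c * u) => _ [y Ay <-]; rewrite ler_pM2l //; apply: Au.
Qed.

Lemma enorm_scale m n (c : R) (A : 'M[R]_(m, n)) : 0 <= c -> enorm (c *: A) = c * enorm A.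
Proof.
move=> c0; rewrite /enorm -[c in RHS](ger0_norm c0) -sqrtr_sqr.
rewrite -sqrtrM ?sqr_ge0 // mulr_sumr; congr Num.sqrt.
apply: eq_bigr => i _; rewrite mulr_sumr; apply: eq_bigr => j _.
by rewrite mxE exprMn.
Qed.

(* No boundedness is needed: the supremum of an unbounded set is 0. *)
Lemma sup_norm_on_scale T m n (K : set T) (g h : T -> 'M[R]_(m, n)) (c : R) :
  0 <= c -> (forall x, h x = c *: g x) -> sup_norm_on K h = c * sup_norm_on K g.
Proof.
move=> c0 hg; rewrite /sup_norm_on -sup_scale //; congr sup.
rewrite image_comp; apply: eq_imagel => x _ /=.
by rewrite hg enorm_scale.
Qed.

Lemma sup_norm_on_ge0 T m n (K : set T) (g : T -> 'M[R]_(m, n)) : 0 <= sup_norm_on K g.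
Proof.
rewrite /sup_norm_on.
have [[[_ [x Kx _]] bK]|no] := pselect (has_sup [set enorm (g x) | x in K]).
  apply: (@le_trans _ _ (enorm (g x))); first exact: sqrtr_ge0.
  by apply: ub_le_sup => //; exists x.
by rewrite sup_out.
Qed.

(** The norms in the series are [e] times the fixed numbers [A k] and [B k]. The first [L.+3] terms
    are small with [e], and the tail is small for every [e] because [x / (1 + x) <= 1]. *)
Lemma C1_dist_small n (a : nat -> 'rV[rat]_n) (r : nat -> rat)
    (p : 'rV[R]_n -> 'rV[R]_n) (L : nat) :
  exists2 e0 : R, 0 < e0 & forall (e : R) (f g : 'rV[R]_n -> 'rV[R]_n),
    0 <= e <= e0 -> (forall x, f x - g x = e *: p x) ->
    (forall x, 'J f x - 'J g x = e *: 'J p x) -> C1_dist a r f g <= 2 ^- L.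
Proof.
pose K k := closure (@rat_ball R n (a k) (r k)).
pose A k := sup_norm_on (K k) p; pose B k := sup_norm_on (K k) (fun x => 'J p x).
have A0 k : 0 <= A k by exact: sup_norm_on_ge0.
have B0 k : 0 <= B k by exact: sup_norm_on_ge0.
pose S := \sum_(0 <= k < L.+3) (A k + B k).
have S0 : 0 <= S by apply: sumr_ge0 => k _; apply: addr_ge0.
(* This makes the head, at most [e * S], at most [2 ^- L.+1]; the added 1 keeps the denominator
   positive. *)
exists (2 ^- L.+1 / (S + 1)) => [|e f g /andP[e0 eS] fg Jfg].
  by rewrite divr_gt0 ?invr_gt0 ?exprn_gt0 //; lra.
rewrite /C1_dist; set u := (fun k : nat => _).
have uE k : u k = 2 ^- k * (e * A k / (1 + e * A k) + e * B k / (1 + e * B k)).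
  rewrite /u -(@sup_norm_on_scale _ _ _ (K k) p (fun x => f x - g x)) //.
  by rewrite -(@sup_norm_on_scale _ _ _ (K k) (fun x => 'J p x) (fun x => 'J f x - 'J g x)).
have frac (x : R) : 0 <= x -> [/\ 0 <= x / (1 + x), x / (1 + x) <= 1 & x / (1 + x) <= x].
  move=> x0; have x1 : 0 < 1 + x by lra.
  split; first by rewrite divr_ge0 // ltW.
    by rewrite ler_pdivrMr //; lra.
  by rewrite ler_pdivrMr //; nra.
have bnd k : [/\ 0 <= u k, u k <= 2 * 2 ^- k & u k <= e * (A k + B k)].
  rewrite uE; have [a1 a2 a3] := frac _ (mulr_ge0 e0 (A0 k)).
  have [b1 b2 b3] := frac _ (mulr_ge0 e0 (B0 k)).
  have h0 : 0 <= 2 ^- k :> R by rewrite invr_ge0 exprn_ge0.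
  have h1 : 2 ^- k <= 1 :> R by rewrite invf_le1 ?exprn_gt0 // exprn_ege1 // ler1n.
  split; first by apply: mulr_ge0 => //; apply: addr_ge0.
    by rewrite mulrC; apply: ler_pM => //; [apply: addr_ge0|lra].
  rewrite -[leRHS]mul1r; apply: ler_pM => //; first by apply: addr_ge0.
  by rewrite mulrDr; apply: lerD.
have ndu : {homo series u : m k / (m <= k)%N >-> m <= k}.
  move=> m k mk; rewrite /series /= (big_cat_nat (leq0n m) mk) //= lerDl.
  by apply: sumr_ge0 => i _; case: (bnd i).
have ub k : series u k <= 2 ^- L.
  apply: le_trans (ndu _ (L.+3 + k)%N (leq_addl _ _)) _.
  (* The terms [2 * 2 ^- i] with [i >= L.+3] sum to [2 ^- L.+1], the other half of the bound. *)
  rewrite /series /= (@big_cat_nat _ _ _ L.+3) ?leq_addr //=.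
  have h1 : \sum_(0 <= i < L.+3) u i <= 2 ^- L.+1.
    apply: (@le_trans _ _ (e * S)).
      by rewrite /S mulr_sumr; apply: ler_sum => i _; case: (bnd i).
    move: eS; rewrite ler_pdivlMr; last by lra.
    by apply: le_trans; rewrite ler_wpM2l //; lra.
  have h2 : \sum_(L.+3 <= i < L.+3 + k) u i <= 2 ^- L.+1.
    apply: (@le_trans _ _ (2 * \sum_(L.+3 <= i < L.+3 + k) (2^-1) ^+ i)).
      rewrite mulr_sumr; apply: ler_sum => i _.
      by rewrite exprVn; case: (bnd i).
    rewrite geometric_partial_tail.
    apply: le_trans (ler_wpM2l _ (geometric_le_lim _ _ _ _)) _ => //.
      by rewrite ger0_norm //; lra.
    rewrite !exprVn !exprS.
    have h : 0 < (2 ^+ L)^-1 :> R by rewrite invr_gt0 exprn_gt0.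
    have -> : 1 - 2^-1 = 2^-1 :> R by lra.
    by rewrite !invfM invrK; lra.
  apply: le_trans (lerD h1 h2) _; rewrite exprS invfM; lra.
apply: limr_le; last by near=> k; exact: ub.
by apply: nondecreasing_is_cvgn => //; exists (2 ^- L) => _ [k _ <-].
Unshelve. all: by end_near. Qed.

End C1Distance.

(** * The vector fields and their unstable manifolds *)

Section VectorField.
Variables (R : realType) (n : nat).
Local Notation V := 'rV[R]_n.+1.
Implicit Types (e : R) (x v : V).

Definition profile e (y : R) : R := (1 - y) ^+ 2 + e * y ^+ 2.

Definition vfield e x : V := profile e (x ord0 ord0) *: x.

(** The profile expanded as [1 - 2 y + (1 + e) y^2], each term times the [i]-th coordinate; for
    [i = ord0] both contributions to the exponent add up. *)
Definition vfield_terms (e : rat) : rat_polymap n.+1 :=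
  [tuple [seq (t.1, [tuple ((j == i) + (j == ord0) * t.2)%N | j < n.+1]) |
          t <- [:: (1, 0%N); (- 2%:R, 1%N); (1 + e, 2%N)]] | i < n.+1].

Lemma polymap_eval_vfield (e : rat) :
  polymap_eval (vfield_terms e) = vfield (ratr e).
Proof.
apply/funext => x; apply/rowP => i; rewrite !mxE tnth_mktuple big_map.
have prodE k : \prod_(j < n.+1)
    x ord0 j ^+ tnth [tuple ((j == i) + (j == ord0) * k)%N | j < n.+1] j =
    x ord0 i * x ord0 ord0 ^+ k.
  under eq_bigr do rewrite tnth_mktuple exprD exprM.
  rewrite big_split /=; congr (_ * _).
    rewrite (bigD1 i) //= eqxx expr1 big1 ?mulr1 // => j /negbTE ->; by rewrite expr0.
  rewrite (bigD1 ord0) //= expr1 big1 ?mulr1 // => j /negbTE ->.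
  by rewrite expr0 expr1n.
rewrite !big_cons big_nil /= !prodE /profile rmorphN (rmorphD _ 1 e) rmorph1 /= ratr_nat.
ring.
Qed.

Lemma is_derive_coord x v j : is_derive x v (fun y : V => y ord0 j) (v ord0 j).
Proof.
have /derivable_mxP dc := @derivable_id _ V x v.
apply: DeriveDef; first exact: dc.
by have := derive_mx (@derivable_id _ V x v); rewrite derive_id => /rowP/(_ j); rewrite mxE.
Qed.

Lemma differentiable_scale_id (g : V -> R) x :
  differentiable g x -> differentiable (fun y => g y *: y) x.
Proof.
move=> dg.
have -> : (fun y => g y *: y) = \sum_j (fun y : V => (g y * y ord0 j) *: delta_mx ord0 j).
  apply/funext => y; rewrite fct_sumE [X in _ *: X = _]row_sum_delta scaler_sumr.
  by apply: eq_bigr => j _; rewrite scalerA.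
apply: differentiable_sum => j; apply: differentiableZl.
by have := differentiableM dg (differentiable_coord x ord0 j).
Qed.

Lemma is_derive_profile e (y : R) :
  is_derive y (1 : R) (profile e) (- 2 * (1 - y) + 2 * e * y).
Proof. by rewrite /profile; apply: is_derive_eq; rewrite !scaler1 /GRing.scale /=; ring. Qed.

Lemma differentiable_coord_comp (g : R -> R) x :
  derivable g (x ord0 ord0) 1 -> differentiable (fun y : V => g (y ord0 ord0)) x.
Proof.
move=> /derivable1_diffP dg; apply: (@differentiable_comp _ _ _ _ (fun y : V => y ord0 ord0) g) => //.
exact: differentiable_coord.
Qed.

Lemma differentiable_profile e x : differentiable (fun y : V => profile e (y ord0 ord0)) x.
Proof. by apply: differentiable_coord_comp; case: (is_derive_profile e (x ord0 ord0)). Qed.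

Lemma differentiable_vfield e x : differentiable (vfield e) x.
Proof. exact/differentiable_scale_id/differentiable_profile. Qed.

(** The slope of [vfield e], which is affine in [e]; it serves as [p] in [C1_dist_small]. *)
Definition perturbation x : V := x ord0 ord0 ^+ 2 *: x.

Lemma differentiable_perturbation x : differentiable perturbation x.
Proof.
by apply/differentiable_scale_id/(differentiable_coord_comp (g := fun y => y ^+ 2)).
Qed.

Lemma vfieldB e x : vfield e x - vfield 0 x = e *: perturbation x.
Proof.
rewrite /vfield /perturbation /profile -scalerBl scalerA; congr (_ *: _); ring.
Qed.

Lemma jacobian_perturb (f g : V -> V) (c : R) x :
  differentiable f x -> differentiable g x -> 'J (f + c *: g) x = 'J f x + c *: 'J g x.
Proof.
move=> df dg; have dcg := @differentiableZ _ _ _ g c x dg.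
have dD : differentiable (f + c *: g) x by exact: differentiableD.
suff H (v : V) : v *m 'J (f + c *: g) x = v *m 'J f x + c *: (v *m 'J g x).
  by apply/row_matrixP => i; rewrite !rowE H mulmxDr scalemxAr.
have E1 := deriveEjacobian v dD.
have E2 := deriveEjacobian v df.
have E3 := deriveEjacobian v dg.
have fv : derivable f x v by exact: diff_derivable.
have gv : derivable g x v by exact: diff_derivable.
have D := deriveD fv (derivableZ (k := c) gv).
rewrite (deriveZ c gv) in D.
exact: etrans (esym E1) (etrans D (congr2 (fun a b => a + c *: b) E2 E3)).
Qed.

Lemma jacobian_vfieldB e x :
  'J (vfield e) x - 'J (vfield 0) x = e *: 'J perturbation x.
Proof.
have -> : vfield e = vfield 0 + e *: perturbation.
  by apply/funext => y /=; rewrite -[RHS]/(vfield 0 y + e *: perturbation y) -vfieldB addrC subrK.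
rewrite jacobian_perturb; last 2 first.
- exact: differentiable_vfield.
- exact: differentiable_perturbation.
by rewrite addrAC subrr add0r.
Qed.

(** In the product rule at 0 the derivative of the profile is multiplied by a vanishing coordinate,
    and the profile itself is 1 there. *)
Lemma jacobian_vfield0 e : 'J (vfield e) 0 = 1%:M.
Proof.
suff Jv v : v *m 'J (vfield e) 0 = v.
  by apply/row_matrixP => i; rewrite !rowE Jv mulmx1.
rewrite -deriveEjacobian; last exact: differentiable_vfield.
have df : derivable (vfield e) 0 v by apply/diff_derivable/differentiable_vfield.
rewrite (derive_mx df); apply/rowP => j; rewrite mxE.
have -> : (fun x => vfield e x ord0 j) =
    (fun x => profile e (x ord0 ord0)) * (fun x => x ord0 j).
  by apply/funext => x; rewrite mxE.
have [dc dcE] := is_derive_coord 0 v j.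
have dp : derivable (fun x : V => profile e (x ord0 ord0)) 0 v.
  by apply/diff_derivable/differentiable_profile.
rewrite (deriveM dp dc) dcE !mxE scale0r addr0 /profile subr0 expr1n expr0n mulr0 addr0.
by rewrite scale1r.
Qed.

End VectorField.

(** * Monotonicity and positivity for scalar equations *)

Section ScalarODE.
Variable R : realType.

Lemma le_of_derive_ge0 (f df : R -> R) (s t : R) : s <= t ->
  (forall u, s <= u <= t -> is_derive u 1 f (df u)) ->
  (forall u, s <= u <= t -> 0 <= df u) -> f s <= f t.
Proof.
rewrite le_eqVlt => /predU1P[-> //|st] fd df0.
have [||c + fE] := @MVT _ f df _ _ st.
- by move=> u; rewrite in_itv /= => /andP[/ltW su /ltW ut]; apply: fd; rewrite su.
- apply: derivable_within_continuous => u; rewrite in_itv /= => /fd.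
  by case.
rewrite in_itv /= => /andP[/ltW sc /ltW ct].
by rewrite -subr_ge0 fE mulr_ge0 ?subr_ge0 ?(ltW st) // df0 // sc.
Qed.

(* If |a| <= K then y^2 exp(2 K u) is nondecreasing, so y has no zero. *)
Lemma linear_ode_gt0 (y a : R -> R) (s t : R) : s <= t ->
  (forall u, s <= u <= t -> is_derive u 1 y (a u * y u)) ->
  {within `[s, t], continuous a} -> 0 < y s -> 0 < y t.
Proof.
move=> st yd ca ys; rewrite ltNge; apply/negP => yt.
have cy : {within `[s, t], continuous y}.
  by apply: derivable_within_continuous => u; rewrite in_itv /= => /yd; case.
have [|u + yu] := IVT st cy (v := 0).
  by rewrite ge_min yt orbT le_max (ltW ys).
rewrite in_itv /= => /andP[su ut].
have [v _ aK] := EVT_min st ca.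
(* Since [a v] is the minimum of [a], [a + K >= 0] on the interval, which gives the derivative below
   its sign. *)
pose K := - a v.
have sub w : s <= w <= u -> s <= w <= t.
  by move=> /andP[-> wu]; exact: le_trans wu ut.
have zd w : s <= w <= u -> is_derive w 1 (fun w => y w ^+ 2 * expR (2 * K * w))
    (2 * (a w + K) * y w ^+ 2 * expR (2 * K * w)).
  move=> /sub/yd dy.
  have de : is_derive w 1 (fun w => expR (2 * K * w)) (expR (2 * K * w) * (2 * K)).
    have dl := is_deriveZ (2 * K) (is_derive_id w (1 : R)).
    apply: (is_derive_eq (is_derive1_comp (is_derive_expR (2 * K * w)) dl)).
    by rewrite /GRing.scale /= mulr1.
  have dy2 := is_deriveX 2 dy.
  apply: (is_derive_eq (is_deriveM dy2 de)).
  rewrite /GRing.scale /= expr1 -[(y ^+ 2) w]/(y w ^+ 2); ring.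
have := le_of_derive_ge0 su zd _; rewrite yu expr0n /= mul0r.
have : 0 < y s ^+ 2 * expR (2 * K * s) by rewrite mulr_gt0 ?exprn_gt0 ?expR_gt0.
rewrite ltNge => /negP y0 h; apply/y0/h => w /sub swt.
rewrite mulr_ge0 ?expR_ge0 // mulr_ge0 ?sqr_ge0 // mulr_ge0 //.
by rewrite /K subr_ge0 aK // in_itv.
Qed.

End ScalarODE.

(** * Trajectories: the barrier and the growth of the norm *)

Section Trajectories.
Variables (R : realType) (n : nat).
Local Notation V := 'rV[R]_n.+1.

Lemma is_derive_row_coord (x : R -> V) (t : R) (d : V) j :
  is_derive t 1 x d -> is_derive t 1 (fun u => x u ord0 j) (d ord0 j).
Proof.
move=> [dx <-]; apply: DeriveDef; first by move/derivable_mxP: dx; apply.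
by rewrite (derive_mx dx) mxE.
Qed.

Lemma is_derive_row (x : R -> V) (t : R) (d : V) :
  (forall j, is_derive t 1 (fun u => x u ord0 j) (d ord0 j)) -> is_derive t 1 x d.
Proof.
move=> xd; have dx : derivable x t 1.
  by apply/derivable_mxP => i j; rewrite (ord1 i); case: (xd j).
apply: DeriveDef => //; rewrite (derive_mx dx); apply/rowP => j; rewrite mxE.
by case: (xd j).
Qed.

Lemma is_derive_shift (x : R -> V) (s t : R) (d : V) :
  is_derive (t - s) 1 x d -> is_derive t 1 (fun u => x (u - s)) d.
Proof.
move=> xd; apply: is_derive_row => j.
have dt : is_derive t 1 (fun u => u - s) (1 : R).
  apply: (is_derive_eq (is_deriveB (is_derive_id t (1 : R)) (is_derive_cst s t 1))).
  by rewrite subr0.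
apply: (is_derive_eq (@is_derive1_comp _ (fun u => x u ord0 j) (fun u => u - s) t _ _
  (is_derive_row_coord j xd) dt)).
by rewrite mulr1.
Qed.

Lemma is_derive_scalel (k : R -> R) (t dk : R) (p : V) :
  is_derive t 1 k dk -> is_derive t 1 (fun u => k u *: p) (dk *: p).
Proof.
move=> dk_; apply: is_derive_row => j.
have -> : (fun u => (k u *: p) ord0 j) = p ord0 j \*: k.
  by apply/funext => u; rewrite mxE /= mulrC.
by apply: (is_derive_eq (is_deriveZ (p ord0 j) dk_)); rewrite mxE mulrC.
Qed.

(* With y = 1 - x_0 the equation reads y' = (- x_0 y) y, linear in y along the
   given solution, so y cannot vanish. *)
Lemma barrier (b c s t : R) (x : R -> V) : solution_on (vfield 0) `]b, c[ x ->
  b < s -> s <= t -> t < c -> x s ord0 ord0 < 1 -> x t ord0 ord0 < 1.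
Proof.
move=> xs bs st tc xs1; pose y u := 1 - x u ord0 ord0.
have xd u : s <= u <= t ->
    is_derive u 1 (fun u => x u ord0 ord0) (y u ^+ 2 * x u ord0 ord0).
  move=> /andP[su ut]; have /xs/(is_derive_row_coord ord0) : `]b, c[%classic u.
    by rewrite /= in_itv /= (lt_le_trans bs su) (le_lt_trans ut tc).
  by rewrite !mxE /profile mul0r addr0.
have yd u : s <= u <= t -> is_derive u 1 y (- (x u ord0 ord0 * y u) * y u).
  move=> /xd dx; apply: (is_derive_eq (is_deriveB (is_derive_cst (1 : R) u 1) dx)).
  rewrite sub0r; ring.
rewrite -subr_gt0; apply: (linear_ode_gt0 st yd); last by rewrite subr_gt0.
apply: derivable_within_continuous => u; rewrite in_itv /= => stu.
apply: derivableN; apply: derivableM; [case: (xd u stu)|case: (yd u stu)] => //.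
Qed.

(** The squared norm has derivative [2 * profile] times itself. This yields backward invariance of
    the unit ball. *)
Lemma sqr_sum_vfield_nondecreasing (e b c s t : R) (x : R -> V) : 0 <= e ->
  solution_on (vfield e) `]b, c[ x -> b < s -> s <= t -> t < c ->
  \sum_j x s ord0 j ^+ 2 <= \sum_j x t ord0 j ^+ 2.
Proof.
move=> e0 xs bs st tc.
apply: (@le_of_derive_ge0 _ (fun u => \sum_j x u ord0 j ^+ 2)
  (fun u => \sum_j 2 * profile e (x u ord0 ord0) * x u ord0 j ^+ 2)) => // u /andP[su ut].
  have xu : `]b, c[%classic u.
    by rewrite /= in_itv /= (lt_le_trans bs su) (le_lt_trans ut tc).
  have dj j := is_deriveX 2 (is_derive_row_coord j (xs _ xu)).
  have := is_derive_sum dj; rewrite (_ : \sum_(i < n.+1) _ = fun u => \sum_j x u ord0 j ^+ 2).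
    move=> h; apply: (is_derive_eq h); apply: eq_bigr => j _.
    by rewrite /GRing.scale /= mxE expr1; ring.
  by apply/funext => v; rewrite fct_sumE.
apply: sumr_ge0 => j _; rewrite mulr_ge0 ?sqr_ge0 // mulr_ge0 //.
by rewrite addr_ge0 ?sqr_ge0 // mulr_ge0 ?sqr_ge0.
Qed.

End Trajectories.

(** * Motion along a ray by separation of variables *)

Section Escape.
Variable R : realType.

(** The two squares do not vanish together. Writing the parameter as [d ^+ 2] keeps square roots out
    of [travel_time]. *)
Lemma profile_gt0 (d y : R) : 0 < d -> 0 < profile (d ^+ 2) y.
Proof.
move=> d0; rewrite /profile; have [->|y0] := eqVneq y 0.
  by rewrite subr0 expr0n mulr0 addr0 expr1n ltr01.
by rewrite ltr_wpDl ?sqr_ge0 // mulr_gt0 // exprn_even_gt0 //= gt_eqF.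
Qed.

(* An explicit antiderivative of s |-> 1 / profile (d^2) (p exp s), found by
   partial fractions of 1 / (y profile (d^2) y) at y = p exp s. *)
Definition travel_time (d p s : R) : R :=
  s - 2^-1 * ln (profile (d ^+ 2) (p * expR s)) +
  d^-1 * atan (((1 + d ^+ 2) * (p * expR s) - 1) / d).

Lemma is_derive_travel_time (d p s : R) : 0 < d ->
  is_derive s 1 (travel_time d p) (profile (d ^+ 2) (p * expR s))^-1.
Proof.
move=> d0; have q0 := profile_gt0 (p * expR s) d0.
have dp : is_derive s 1 (fun s => p * expR s) (p * expR s).
  exact: (is_deriveZ p (is_derive_expR s)).
have dq := @is_derive1_comp _ _ (fun s => p * expR s) _ _ _
  (is_derive_profile (d ^+ 2) (p * expR s)) dp.
have dl := is_deriveZ 2^-1 (@is_derive1_comp _ _ (fun s => profile (d ^+ 2) (p * expR s))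
  _ _ _ (is_derive1_ln q0) dq).
have dg : is_derive s 1 (fun s => ((1 + d ^+ 2) * (p * expR s) - 1) / d)
    ((1 + d ^+ 2) * (p * expR s) / d).
  have := is_deriveB (is_deriveZ (1 + d ^+ 2) dp) (is_derive_cst (1 : R) s 1).
  move=> /(is_deriveZ d^-1) h.
  have -> : (fun s => ((1 + d ^+ 2) * (p * expR s) - 1) / d) =
      d^-1 \*: ((1 + d ^+ 2) \*: (fun s => p * expR s) - cst 1).
    by apply/funext => u; rewrite /= mulrC.
  by apply: (is_derive_eq h); rewrite subr0 /GRing.scale /= mulrC.
have da := is_deriveZ d^-1 (@is_derive1_comp _ _
  (fun s => ((1 + d ^+ 2) * (p * expR s) - 1) / d) _ _ _ (is_derive1_atan _) dg).
apply: (is_derive_eq (is_deriveD (is_deriveB (is_derive_id s (1 : R)) dl) da)).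
rewrite /GRing.scale /=.
set y := p * expR s in q0 *; rewrite /profile in q0 *.
have h1 : 1 + (((1 + d ^+ 2) * y - 1) / d) ^+ 2 != 0.
  by rewrite gt_eqF // ltr_pwDl // sqr_ge0.
field.
apply/and3P; split; rewrite gt_eqF //; first by rewrite exprMn.
by rewrite ltr_pwDl ?exprn_gt0 ?sqr_ge0.
Qed.

Lemma travel_time_lt (d p : R) : 0 < d -> {homo travel_time d p : s t / s < t}.
Proof.
move=> d0 s t st.
have Td u := is_derive_travel_time p u d0.
have [|u _ E] := @MVT _ (travel_time d p) _ _ _ st (fun u _ => Td u).
  by apply: derivable_within_continuous => u _; case: (Td u).
by rewrite -subr_gt0 E mulr_gt0 ?subr_gt0 // invr_gt0 profile_gt0.
Qed.

(** The profile has minimum [d^2 / (1 + d^2)], at [y = 1 / (1 + d^2)], and the arctangent is below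
    [pi / 2]. Hence the travel time tends to -oo with [s], so that trajectories exist for all
    negative times. *)
Lemma travel_time_le (d p : R) : 0 < d -> exists C, forall s, travel_time d p s <= s + C.
Proof.
move=> d0; have m0 : 0 < d ^+ 2 / (1 + d ^+ 2).
  by rewrite divr_gt0 ?exprn_gt0 // ltr_pwDl // sqr_ge0.
exists (- (2^-1 * ln (d ^+ 2 / (1 + d ^+ 2))) + d^-1 * (pi / 2)) => s.
rewrite /travel_time -addrA lerD2l; apply: lerD.
  rewrite lerN2 ler_pM2l // ler_ln ?posrE //; last exact: profile_gt0.
  set y := p * expR s; rewrite ler_pdivrMr ?ltr_pwDl ?sqr_ge0 //.
  rewrite -subr_ge0 /profile.
  have -> : ((1 - y) ^+ 2 + d ^+ 2 * y ^+ 2) * (1 + d ^+ 2) - d ^+ 2 =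
    ((1 + d ^+ 2) * y - 1) ^+ 2 by ring.
  exact: sqr_ge0.
by rewrite ler_pM2l ?invr_gt0 // ltW // atan_ltpi2.
Qed.

(** Here [sigma] is the logarithm of the scaling factor along the ray of a point with first
    coordinate [p]. It is the inverse of the travel time, shifted to vanish at time 0. *)
Lemma scalar_escape (d p : R) : 0 < d -> exists (sigma : R -> R) (c : R),
  [/\ 0 < c, sigma 0 = 0,
      forall t, t < c -> is_derive t 1 sigma (profile (d ^+ 2) (p * expR (sigma t))) &
      forall M, exists t0, forall t, t < t0 -> sigma t < M].
Proof.
move=> d0; set T := travel_time d p.
have Td (u : R) : is_derive u (1 : R) T (profile (d ^+ 2) (p * expR u))^-1.
  exact: is_derive_travel_time.
have Tlt := travel_time_lt p d0 : {homo T : s t / s < t}.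
have Tmono := leW_mono (le_mono Tlt) : {mono T : s t / s < t}.
have Tinj : injective T := inc_inj (le_mono Tlt).
have [C TC] := travel_time_le p d0.
have cT : continuous T.
  by move=> u; apply: differentiable_continuous; apply/derivable1_diffP; case: (Td u).
have Tsurj t : t < T 1 -> exists s, T s = t.
  move=> t1; pose a := Num.min 1 (t - C).
  have Ta : T a <= t.
    by apply: le_trans (TC a) _; rewrite -lerBrDr /a ge_min lexx orbT.
  have a1 : a <= 1 by rewrite /a ge_min lexx.
  have [||s _ sE] := @IVT _ T _ _ t a1; last by exists s.
    exact: continuous_subspaceT.
  by rewrite ge_min Ta le_max (ltW t1) orbT.
pose tau t := xget 0 [set s | T s = t].
have tauK : cancel T tau by move=> s; apply: xget_unique => // s' /Tinj.
have taud s : is_derive (T s) 1 tau (profile (d ^+ 2) (p * expR s)).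
  rewrite -[profile _ _]invrK; apply: is_derive_inverse (Td s) _.
  - by apply: filterE => u; exact: tauK.
  - by apply: filterE => u; exact: cT.
  - by rewrite invr_neq0 // gt_eqF // profile_gt0.
(* Any level above [sigma 0 = 0] would do in place of 1: some positive lifetime suffices. *)
exists (fun t => tau (t + T 0)), (T 1 - T 0); split.
- by rewrite subr_gt0 Tmono.
- by rewrite add0r tauK.
- move=> t; rewrite ltrBrDr => /Tsurj[s sE].
  have dt : is_derive t 1 (fun u => u + T 0) (1 : R).
    apply: (is_derive_eq (is_deriveD (is_derive_id t (1 : R)) (is_derive_cst (T 0) t 1))).
    by rewrite addr0.
  have ds := taud s; rewrite sE in ds.
  apply: (is_derive_eq (@is_derive1_comp _ tau (fun u => u + T 0) t _ _ ds dt)).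
  by rewrite mulr1 -sE tauK.
- move=> M; exists (Num.min (T 1) (T M) - T 0) => t.
  rewrite ltrBrDr lt_min => /andP[/Tsurj[s <-]].
  by rewrite tauK Tmono.
Qed.

End Escape.

(** * Positive parameter: the unstable manifold is the whole space *)

Section GlobalUnstableManifold.
Variables (R : realType) (n : nat) (d : R).
Hypothesis d0 : 0 < d.
Local Notation V := 'rV[R]_n.+1.

Lemma radial_escape (p : V) : exists (k : R -> R) (c : R),
  [/\ 0 < c, k 0 = 1,
      solution_on (vfield (d ^+ 2)) `]-oo, c[ (fun t => k t *: p) &
      forall e, 0 < e -> exists t0, forall t, t < t0 -> 0 <= k t < e].
Proof.
have [sigma [c [c0 s0 sd sM]]] := scalar_escape (p ord0 ord0) d0.
exists (fun t => expR (sigma t)), c; split=> //; first by rewrite s0 expR0.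
  move=> t; rewrite /= in_itv /= => tc.
  have := is_derive_scalel p (is_derive1_comp (is_derive_expR _) (sd t tc)).
  move=> h; apply: (is_derive_eq h).
  by rewrite /vfield scalerA mulrC mxE [_ * expR _]mulrC.
move=> e e0; have [t0 ht0] := sM (ln e); exists t0 => t /ht0.
by rewrite expR_ge0 /= -ltr_expR lnK.
Qed.

Lemma enormE (p : V) : enorm p = Num.sqrt (\sum_j p ord0 j ^+ 2).
Proof. by rewrite /enorm big_ord1. Qed.

Lemma eball01E (p : V) : eball 0 1 p = (\sum_j p ord0 j ^+ 2 < 1) :> Prop.
Proof. by rewrite /eball /= subr0 enormE -{1}(@sqrtr1 R) ltr_sqrt ?ltr01. Qed.

Lemma jacobian_id (x : V) : 'J id x = 1%:M.
Proof.
suff H (v : V) : v *m 'J id x = v.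
  by apply/row_matrixP => i; rewrite !rowE H mulmx1.
rewrite -deriveEjacobian; last by case: (@is_diff_id _ V x).
exact: derive_id.
Qed.

Lemma complexified1 : complexified (1%:M : 'M[R]_n.+1) = 1%:M.
Proof. exact: map_mx1. Qed.

Lemma unstable_subspace1 (v : V) : unstable_subspace 1%:M v.
Proof.
exists [:: complexified v]; last by rewrite big_seq1.
move=> w _; exists 1, 1%N; split; first exact: ltr01.
by rewrite /= complexified1 subrr mulmx0.
Qed.

(** The linearization is the identity, so the unstable subspace is everything and the identity map
    is a chart. The norm grows along trajectories, and [radial_escape] provides convergence to 0 in
    the past. *)
Lemma unit_ball_local_unstable_manifold :
  local_unstable_manifold (vfield (d ^+ 2)) (0 : V) (eball 0 1).
Proof.
split.
- exists n.+1, id; split; [split| by rewrite image_id|by []|].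
  + by move=> y _; case: (@is_diff_id _ V y).
  + move=> y _; have -> : (fun y : V => 'J id y) = cst 1%:M.
      by apply/funext => z; rewrite jacobian_id.
    exact: cst_continuous.
  + by move=> y _; rewrite jacobian_id row_free_unit unitmx1.
  + exists id => //; apply: continuous_subspaceT => y; exact: cvg_id.
  + move=> v; rewrite jacobian_id jacobian_vfield0 submx1.
    by split=> // _; exact: unstable_subspace1.
- move=> t t0 p [x [b [c [/andP[b0 c0] /andP[bt tc] xs]]]].
  rewrite !eball01E => x0 <-; apply: le_lt_trans x0.
  by apply: sqr_sum_vfield_nondecreasing xs _ _ _ => //; exact: sqr_ge0.
- move=> p _; have [k [c [c0 k0 xs kM]]] := radial_escape p.
  exists (fun t => k t *: p), c; split => //; first by rewrite k0 scale1r.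
  rewrite -[X in _ --> X](scale0r p); apply: cvgZr_tmp.
  apply/cvgr0Pnorm_lt => e /kM[t0 ht0]; exists t0; split; first exact: num_real.
  by move=> t /ht0 /andP[kt0 kte]; rewrite ger0_norm.
Qed.

(** The trajectory through [p] is followed back along its ray into the unit ball, to an integer time
    [- j]; flowing forward for time [j] returns to [p]. *)
Lemma unstable_manifold_vfield : unstable_manifold (vfield (d ^+ 2)) (0 : V) = setT.
Proof.
apply/seteqP; split=> // p _.
have [k [c [c0 k0 xs kM]]] := radial_escape p.
(* This bound on [k t] puts [k t *: p] in the unit ball. *)
have [t0 ht0] : exists t0, forall t, t < t0 -> 0 <= k t < (enorm p + 1)^-1.
  by apply: kM; rewrite invr_gt0 ltr_wpDl // sqrtr_ge0.
exists (eball 0 1); first exact: unit_ball_local_unstable_manifold.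
pose j := (Num.Def.truncn `|t0|).+1; exists j => //.
have jt : - j%:R < t0.
  rewrite ltrNl; apply: le_lt_trans (truncnS_gt `|t0|).
  by rewrite -normrN ler_norm.
(* The same trajectory with its clock started at [- j]; the left end -1 is an arbitrary negative
   time. *)
exists (fun t => k (t - j%:R) *: p), (- 1), (j%:R + c); split.
- by rewrite ltrN10 ltr_wpDl.
- by rewrite (lt_le_trans (ltrN10 R)) //= ltrDl.
- move=> t; rewrite /= in_itv /= => /andP[_ tc].
  have := xs (t - j%:R); rewrite /= in_itv /= ltrBlDl => /(_ tc) dk.
  exact: is_derive_shift dk.
- rewrite sub0r; have /andP[k0j kj] := ht0 _ jt.
  rewrite /eball /= subr0 enorm_scale //.
  apply: le_lt_trans (_ : _ <= (enorm p + 1)^-1 * enorm p) _.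
    by rewrite ler_wpM2r ?sqrtr_ge0 // ltW.
  by rewrite mulrC ltr_pdivrMr ?mul1r ?ltrDl // ltr_wpDl // sqrtr_ge0.
- by rewrite subrr k0 scale1r.
Qed.

End GlobalUnstableManifold.

(** * Parameter zero: confinement to a half-space; hyperbolicity *)

Section AtZero.
Variables (R : realType) (n : nat).
Local Notation V := 'rV[R]_n.+1.

(** A point of [U] has a past converging to 0, hence with first coordinate below 1 at some negative
    time. The barrier carries this to time 0, then along the flow to time [j]. *)
Lemma unstable_manifold_vfield0 (p : V) :
  unstable_manifold (vfield 0) 0 p -> p ord0 ord0 < 1.
Proof.
move=> [U [_ _ Uback] [j _ [y [b [c [/andP[b0 c0] /andP[bj jc] ys y0 <-]]]]]].
apply: (barrier ys b0) => //.
have [x [c' [c'0 xs <- x0]]] := Uback _ y0.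
have x00 : x t ord0 ord0 @[t --> -oo] --> (0 : R).
  have := cvg_comp _ _ x0 (@coord_continuous _ _ _ ord0 ord0 (0 : V)).
  by rewrite mxE.
have [M [_ xM]] := cvgr0_norm_lt _ x00 _ (ltr01 : 0 < 1 :> R).
(* A time before 0 and early enough for the first coordinate to be below 1. *)
pose s := Num.min M 0 - 1.
have sM : s < M by rewrite /s ltrBlDr (le_lt_trans (_ : _ <= M)) ?ge_min ?lexx // ltrDl.
have s0 : s < 0 by rewrite /s ltrBlDr add0r (le_lt_trans (_ : _ <= 0)) ?ge_min ?lexx ?orbT.
have xs' : solution_on (vfield 0) `]s - 1, c'[ x.
  by move=> t; rewrite /= in_itv /= => /andP[_ tc]; apply: xs; rewrite /= in_itv.
apply: (barrier xs' _ (ltW s0)) => //; first by rewrite ltrBlDr ltrDl.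
exact: le_lt_trans (ler_norm _) (xM _ sM).
Qed.

Lemma closure_unstable_manifold_vfield0 (p : V) :
  closure (unstable_manifold (vfield 0) 0) p -> p ord0 ord0 <= 1.
Proof.
move=> cp; pose f (x : V) := x ord0 ord0.
apply: (@preimage_closed _ _ f [set y | y <= 1]).
- by move=> x _; exact: coord_continuous.
- exact: closed_le.
- apply: closure_subset cp => x /unstable_manifold_vfield0; exact: ltW.
Qed.

Lemma hyperbolic_vfield (e : R) : hyperbolic_equilibrium (vfield e) (0 : V).
Proof.
split; first by rewrite /vfield scaler0.
move=> z; rewrite jacobian_vfield0 complexified1 => /eigenvalueP[v].
rewrite mulmx1 -[X in X = _]scale1r => /eqP.
rewrite -subr_eq0 -scalerBl scaler_eq0 => /orP[|/eqP ->]; last by rewrite eqxx.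
by rewrite subr_eq0 => /eqP <- _; rewrite /= oner_eq0.
Qed.

Lemma psi_dom_vfield (e : rat) : psi_dom (vfield (ratr e : R), 0 : V).
Proof.
split=> /=; last exact: hyperbolic_vfield.
by rewrite -polymap_eval_vfield; exact: polymap_analytic.
Qed.

End AtZero.

(** * Two names with a common prefix and incompatible images *)

Theorem theorem13 (R : realType) (n : nat) (hn : (0 < n)%N)
    (a : nat -> 'rV[rat]_n) (r : nat -> rat)
    (hcover : computable_ball_cover R a r) :
  ~ type2_computable (pair_name (@function_name R n a r) (@point_name R n))
      (@closed_set_name R n) (@psi_dom R n) (@psi R n).
Proof.
case: n hn a r hcover => // n _ a r _ [M HM].
pose name0 : nat -> nat := fun=> pickle (0 : 'rV[rat]_n.+1).
have point0 : point_name name0 (0 : 'rV[R]_n.+1).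
  exists (fun=> 0) => k; split=> // i.
  by rewrite !mxE rmorph0 subrr normr0 invr_ge0 exprn_ge0.
(* The name of the field with parameter e whose first entries are those of the
   constant name of the field with parameter 0. *)
pose name (e : rat) (L m : nat) : nat :=
  if odd m then name0 m else pickle (vfield_terms n (if (m./2 <= L)%N then 0 else e)).
have distxx (f : 'rV[R]_n.+1 -> 'rV[R]_n.+1) l : C1_dist a r f f <= 2 ^- l.
  have [e1 e10 H] := C1_dist_small a r f l.
  (* The perturbation estimate with parameter 0 and [f] itself as perturbation. *)
  apply: (H 0) => [|x|x]; first by rewrite lexx ltW.
    by rewrite subrr scale0r.
  by rewrite subrr scale0r.
have nameP (e : rat) (L : nat) :
    C1_dist a r (vfield (ratr e)) (vfield 0) <= 2 ^- L :> R ->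
    pair_name (@function_name R n.+1 a r) (@point_name R n.+1) (name e L)
      (vfield (ratr e), 0).
  move=> eL; split=> /=; last first.
    suff -> : snd_name (name e L) = name0 by [].
    by apply/funext => k; rewrite /snd_name /name /= odd_double.
  exists (fun l => vfield_terms n (if (l <= L)%N then 0 else e)) => l; split.
    by rewrite /fst_name /name odd_double doubleK.
  rewrite polymap_eval_vfield; case: leqP => [lL|_]; last exact: distxx.
  rewrite rmorph0; apply: le_trans eL _.
  by rewrite lef_pV2 ?posrE ?exprn_gt0 // ler_eXn2l // ltr1n.
have d00 : C1_dist a r (vfield (ratr 0)) (vfield 0) <= 2 ^- 0 :> R.
  by rewrite rmorph0; exact: distxx.
have [q qP [_ [c [s [qE cE]]]]] := HM _ _ (psi_dom_vfield R n 0) (nameP _ _ d00).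
pose pt : 'rV[R]_n.+1 := 2 *: delta_mx ord0 ord0.
have : (~` psi (vfield (ratr 0 : R), 0)) pt.
  rewrite /psi /= rmorph0 => /closure_unstable_manifold_vfield0.
  by rewrite !mxE mulr1 lern1.
rewrite cE => -[k _ kpt].
(* The [k]-th ball of the complement is coded at index [k.*2.+1] of the interleaved output name. *)
have [t tP] := computes_prefix qP k.*2.+1.
have [e1 e10 H] := C1_dist_small a r (@perturbation R n) t.
(* The parameter is a rational square: rational for the polynomial names, a square for the travel
   time. With [N > 1 / e1], [d = 2 ^- N] satisfies [d^2 <= d <= e1]. *)
have [d d0 de1] : exists2 d : rat, 0 < d & ratr d ^+ 2 <= e1.
  pose N := (Num.Def.truncn e1^-1).+1; exists (2 ^- N); first by rewrite invr_gt0 exprn_gt0.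
  have x0 : 0 < 2 ^+ N :> R by rewrite exprn_gt0.
  have x1 : 2 ^- N <= 1 :> R by rewrite invf_le1 // exprn_ege1 // ler1n.
  have xe : 2 ^- N <= e1.
    rewrite -[e1]invrK lef_pV2 ?posrE ?invr_gt0 //.
    apply: ltW; apply: lt_trans (truncnS_gt e1^-1) _.
    by rewrite -natrX ltr_nat ltn_expl.
  rewrite fmorphV rmorphXn /= ratr_nat expr2.
  by rewrite -[e1]mul1r ler_pM // invr_ge0 ltW.
have dt : C1_dist a r (vfield (ratr (d ^+ 2))) (vfield 0) <= 2 ^- t :> R.
  apply: (H (ratr (d ^+ 2))); [|exact: vfieldB|exact: jacobian_vfieldB].
  by rewrite rmorphXn /= sqr_ge0.
have [q' q'P [_ [c' [s' [q'E c'E]]]]] :=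
  HM _ _ (psi_dom_vfield R n (d ^+ 2)) (nameP _ _ dt).
have agree m : (m <= t)%N -> name 0 0%N m = name (d ^+ 2) t m.
  move=> mt; rewrite /name if_same (leq_trans _ mt) //.
  by rewrite leq_half_double -addnn leqW ?leq_addr.
have := tP _ _ q'P agree k.*2.+1 (leqnn _).
rewrite -[q _]/(snd_name q k) -[q' _]/(snd_name q' k) qE q'E.
move=> /(pcan_inj pickleK)[ck sk].
(* The ball containing [pt] is also listed for the perturbed field, whose unstable manifold is
   everything. *)
have : (~` psi (vfield (ratr (d ^+ 2) : R), 0)) pt.
  by rewrite c'E; exists k => //; rewrite -ck -sk.
apply; apply: subset_closure.
by rewrite /= rmorphXn unstable_manifold_vfield // ltr0q.
Qed.
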